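(* Let $N\ge1$, $\delta>0$, $\alpha>0$. Suppose each $c_n:\mathbb{R}\to\mathbb{R}$ ($n=1,\dots,N$) is continuous, satisfies $c_n(s)=0$ for $s\le 0$, and is convex and strictly increasing on $[0,\infty)$. Suppose also that the socially optimal on-site generation is non-zero, i.e. the social cost minimization problem has an optimal solution $(\mathbf{s}^*,y^* )$ with $y^*>0$. Then there is a unique price-taking market equilibrium, i.e. a vector $\mathbf{b}^t=(b_1^t,\dots,b_N^t)\ge 0$, $y^t>0$ and a scalar $p^t>0$ such that (i) $P_n(b^t_n;p^t)\ge P_n(\bar b_n;p^t)$ for all $\bar b_n\ge 0$ and all $n$; (ii) $p^t=\frac{\sum_i b^t_i}{(N-1)\delta+y^t}$; (iii) $y^t\in\arg\min_{0\le y\le\delta}\ (\delta-y)\,p(\mathbf{b}^t,y)+\alpha y$; and the resulting allocation $(\mathbf{s}^t,y^t)$, where $s_n^t=S(b_n^t,p^t)$, is the optimal solution of $$\min_{\mathbf{s},y}\ \sum_{n}c_n(s_n)+\frac{\alpha}{2N\delta}\bigl(y+(N-1)\delta\bigr)^2\quad\text{s.t.}\quad \sum_n s_n=\delta-y,\quad s_n\ge0\ \forall n,\quad y\ge 0.$$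
   Context: There are $N$ tenants; $\delta$ is the total energy reduction target; $y$ is the amount of on-site generation, with unit cost $\alpha$. The social cost minimization problem is $$\min\ \alpha y+\sum_{i=1}^N c_i(s_i)\quad\text{s.t.}\quad y+\sum_{i=1}^N s_i=\delta,\ s_i\ge0,\ y\ge0.$$ Supply function: $S(b_n,p)=\delta-\frac{b_n}{p}$ for bid $b_n\ge0$ and price $p>0$. Clearing price given bids and generation: $p(\mathbf{b},y)=\frac{\sum_n b_n}{(N-1)\delta+y}$, with the conventions $0/0=0$ and $x/0=+\infty$ for $x>0$. Payoff of a price-taking tenant: $P_n(b_n;p)=p\delta-b_n-c_n\!\left(\delta-\frac{b_n}{p}\right)$.
   Formalization: Uniqueness of the equilibrium fails in general (N=δ=α=1, c(s)=10 max(0,s): every price in [1,10] works). Proved: existence; equilibrium allocations are exactly the optimal solutions; y is unique, p if y<δ, the allocation if costs are strictly convex, (b,y,p) if both. *)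

(* Defs.v *)
(* MathComp-Analysis world. *)
From mathcomp Require Import all_boot all_order all_algebra.
From mathcomp Require Import all_classical all_reals all_analysis.

Set Implicit Arguments.
Unset Strict Implicit.
Unset Printing Implicit Defensive.

Import Order.TTheory GRing.Theory Num.Theory.
Import numFieldNormedType.Exports.

Local Open Scope classical_set_scope.
Local Open Scope ring_scope.

Definition is_argmin (d : Order.disp_t) (V : porderType d) (T : Type)
    (A : set T) (f : T -> V) (x : T) : Prop :=
  A x /\ forall z, A z -> (f x <= f z)%O.

Definition cost_function (R : realType) (c : R -> R) : Prop :=
  [/\ continuous c,
      forall s, s <= 0 -> c s = 0,
      convex_function (`[0, +oo[ : set R) c
    & {in `[0, +oo[ &, {homo c : x y / x < y}}].

Definition strictly_convex_nneg (R : realType) (c : R -> R) : Prop :=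
  forall x y t : R, 0 <= x -> 0 <= y -> x != y -> 0 < t -> t < 1 ->
    c (t * x + (1 - t) * y) < t * c x + (1 - t) * c y.

(* Pairs (s, y): energy reductions of the N tenants, on-site generation. *)
Definition feasible (R : realType) (N : nat) (delta : R) :
    set (('I_N -> R) * R) :=
  [set a | [/\ a.2 + \sum_(n < N) a.1 n = delta,
               forall n, 0 <= a.1 n & 0 <= a.2]].

Definition social_cost (R : realType) (N : nat) (alpha : R)
    (c : 'I_N -> R -> R) (a : ('I_N -> R) * R) : R :=
  alpha * a.2 + \sum_(n < N) c n (a.1 n).

Definition modified_cost (R : realType) (N : nat) (delta alpha : R)
    (c : 'I_N -> R -> R) (a : ('I_N -> R) * R) : R :=
  \sum_(n < N) c n (a.1 n)
  + alpha / (2 * N%:R * delta) * (a.2 + (N%:R - 1) * delta) ^+ 2.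

Definition supply (R : realType) (delta b p : R) : R := delta - b / p.

(* The extended-real division used here satisfies 0 / 0 = 0 and
   x / 0 = +oo for x > 0; the denominator vanishes only for N = 1, y = 0. *)
Definition clearing_price (R : realType) (N : nat) (delta : R)
    (b : 'I_N -> R) (y : R) : \bar R :=
  ((\sum_(n < N) b n)%:E / ((N%:R - 1) * delta + y)%:E)%E.

Definition payoff (R : realType) (delta : R) (cn : R -> R) (bn p : R) : R :=
  p * delta - bn - cn (supply delta bn p).

Definition operator_cost (R : realType) (N : nat) (delta alpha : R)
    (b : 'I_N -> R) (y : R) : \bar R :=
  ((delta - y)%:E * clearing_price delta b y + (alpha * y)%:E)%E.

Definition price_taking_equilibrium (R : realType) (N : nat)
    (delta alpha : R) (c : 'I_N -> R -> R)
    (b : 'I_N -> R) (y p : R) : Prop :=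
  [/\ (forall n, 0 <= b n) /\ 0 < y /\ 0 < p,
      forall n (bbar : R), 0 <= bbar ->
        payoff delta (c n) bbar p <= payoff delta (c n) (b n) p,
      p%:E = clearing_price delta b y
    & is_argmin (`[0, delta] : set R) (operator_cost delta alpha b) y].

Definition allocation (R : realType) (N : nat) (delta : R)
    (b : 'I_N -> R) (y p : R) : ('I_N -> R) * R :=
  (fun n => supply delta (b n) p, y).

(* Main.v *)
(* Write D = (N-1) delta + y.  A price-taking tenant with allocation s_n
   maximizes p s - c_n s over s <= delta, and (ii) says exactly that
   y + sum s_n = delta.  Up to a constant the operator's cost is
   N delta p D(y) / D + alpha D with p the equilibrium price, so (iii) becomes
   alpha D <= N delta p, with equality if y < delta.  Together these are the
   KKT conditions of the modified problem, whose marginal cost of generation is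
   alpha D / (N delta), with p as the multiplier of the balance constraint.
   Conversely an optimum with y > 0 satisfies them, as perturbing one s_n
   against y shows.  An optimum with y = 0 is beaten by the social optimum: the
   quadratic term increases from 0 to y* by strictly less than alpha y*, because
   y* < 2 delta.  For uniqueness, adding the tenants' inequalities at two
   equilibria gives (p - p') (y - y') <= 0, whereas (iii) makes p strictly
   increasing in y. *)
Require Import Defs.
From mathcomp Require Import all_boot all_order all_algebra.
From mathcomp Require Import all_classical all_reals all_analysis.
From mathcomp Require Import ring lra.
Import Order.TTheory GRing.Theory Num.Theory.
Import numFieldNormedType.Exports.
Local Open Scope ring_scope.

(** * Tools for convexity and one-sided perturbation *)

Lemma cost_convex {R : realType} {c : R -> R} : cost_function c ->
  forall x y t : R, 0 <= x -> 0 <= y -> 0 <= t -> t <= 1 ->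
    c (t * x + (1 - t) * y) <= t * c x + (1 - t) * c y.
Proof.
move=> [_ _ cvx _] x y t x0 y0 t0 t1.
have /= := cvx (Itv01 t0 t1) x y.
rewrite !inE /= !in_itv /= !andbT => /(_ x0 y0).
by rewrite !convRE.
Qed.

(** Let [t] tend to 0. This extracts first-order conditions without derivatives, as the costs need
    not be differentiable. *)
Lemma ge0_of_small_perturbation {R : realType} {a b t0 : R} : 0 < t0 ->
  (forall t, 0 < t -> t <= t0 -> 0 <= a + t * b) -> 0 <= a.
Proof.
move=> t0_gt0 H; rewrite leNgt; apply/negP => a0.
have b0 : 0 < 2 * (`|b| + 1) by rewrite mulr_gt0 ?ltr_wpDl.
have m0 : 0 < Num.min t0 (- a / (2 * (`|b| + 1))).
  by rewrite lt_min t0_gt0 divr_gt0 ?oppr_gt0.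
have := H _ m0; rewrite ge_min lexx => /(_ isT); apply/negP; rewrite -ltNge.
set t := Num.min _ _ in m0 *.
have : t * (2 * (`|b| + 1)) <= - a by rewrite -ler_pdivlMr // ge_min lexx orbT.
by have := ler_norm b; nra.
Qed.

(** Serves to perturb a single tenant: [fun=> id] for [F] gives the balance constraint, [c] the
    total cost. *)
Lemma sum_update {R : realType} {N : nat} {F : 'I_N -> R -> R}
    {s : 'I_N -> R} (n : 'I_N) (v : R) :
  \sum_(i < N) F i (if i == n then v else s i) =
  \sum_(i < N) F i (s i) + (F n v - F n (s n)).
Proof.
rewrite (bigD1 n) //= [in RHS](bigD1 n) //= eqxx.
rewrite (eq_bigr (fun i => F i (s i))); last by move=> i /negPf ->.
by ring.
Qed.

(** * The operator's choice of generation *)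

Lemma operator_costE (R : realType) (N : nat) (delta alpha : R)
    (b : 'I_N -> R) (z : R) : 0 < (N%:R - 1) * delta + z ->
  operator_cost delta alpha b z =
  ((delta - z) * ((\sum_(n < N) b n) / ((N%:R - 1) * delta + z)) + alpha * z)%:E.
Proof.
by move=> D0; rewrite /operator_cost /clearing_price inver gt_eqF.
Qed.

Lemma denominator_gt0 {R : realType} {N : nat} {delta z : R} :
  (1 <= N)%N -> 0 < delta -> 0 < z -> 0 < (N%:R - 1) * delta + z.
Proof.
move=> hN hdelta z0; rewrite ltr_wpDl //.
by apply: mulr_ge0; [rewrite subr_ge0 ler1n|exact: ltW].
Qed.

(** Write D(z) for the denominator at z. The cost at z minus the cost at y, multiplied by D(z) > 0,
    factors as (y - z)(N delta p - alpha D(z)), so only signs matter. Points z below y give the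
    inequality; points above, available when y < delta, give the converse one. *)
Lemma operator_argminP {R : realType} {N : nat} {delta alpha : R}
    {b : 'I_N -> R} {y p : R} :
  (1 <= N)%N -> 0 < delta -> 0 < alpha -> 0 < y -> 0 < p ->
  \sum_(n < N) b n = p * ((N%:R - 1) * delta + y) ->
  is_argmin (`[0, delta]%classic : set R) (operator_cost delta alpha b) y <->
  [/\ y <= delta, alpha * ((N%:R - 1) * delta + y) <= N%:R * delta * p
    & y < delta -> alpha * ((N%:R - 1) * delta + y) = N%:R * delta * p].
Proof.
move=> hN hdelta halpha y0 p0 Bp.
have Nm1_ge0 : 0 <= (N%:R - 1) * delta :> R.
  by apply: mulr_ge0; [rewrite subr_ge0 ler1n|exact: ltW].
have D_gt0 (z : R) : 0 < z -> 0 < (N%:R - 1) * delta + z.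
  exact: denominator_gt0.
have le_cost (z : R) : 0 < (N%:R - 1) * delta + z ->
    (operator_cost delta alpha b y <= operator_cost delta alpha b z)%E =
    (0 <= (y - z) * (N%:R * delta * p - alpha * ((N%:R - 1) * delta + z))).
  move=> Dz; have Dy := D_gt0 _ y0.
  rewrite !operator_costE // lee_fin -subr_ge0 Bp -(pmulr_lge0 _ Dz).
  congr (0 <= _); field; by rewrite !gt_eqF.
split=> [[/= yI ymin]|[yd le_p eq_p]].
  have yd : y <= delta by move: yI; rewrite in_itv /= => /andP[].
  have ge (z : R) : 0 < z -> z <= delta ->
      0 <= (y - z) * (N%:R * delta * p - alpha * ((N%:R - 1) * delta + z)).
    move=> z0 zd; rewrite -le_cost ?D_gt0 //.
    by apply: ymin; rewrite /= in_itv /= zd ltW.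
  have le_p : alpha * ((N%:R - 1) * delta + y) <= N%:R * delta * p.
    (* Test z = (1 - t) y and divide by t y. The bound t <= 1/2 keeps z positive, away from a
       possibly zero denominator. *)
    rewrite -subr_ge0; apply: (@ge0_of_small_perturbation _ _ (alpha * y) 2^-1).
      by rewrite invr_gt0.
    move=> t t0 t1; have ty0 : 0 < t * y by rewrite mulr_gt0.
    rewrite -(pmulr_rge0 _ ty0).
    have h1 : 0 < y - t * y by nra.
    have h2 : y - t * y <= delta by lra.
    by have := ge _ h1 h2; congr (0 <= _); ring.
  split=> // ltyd; apply/eqP; rewrite eq_le le_p /= -subr_ge0.
  apply: (@ge0_of_small_perturbation _ _ (alpha * (delta - y)) 1) => // t t0 t1.
  have tdy0 : 0 < t * (delta - y) by rewrite mulr_gt0 ?subr_gt0.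
  rewrite -(pmulr_rge0 _ tdy0).
  have h1 : 0 < y + t * (delta - y) by lra.
  have h2 : y + t * (delta - y) <= delta by nra.
  by have := ge _ h1 h2; congr (0 <= _); ring.
split=> [|z]; first by rewrite /= in_itv /= yd ltW.
rewrite /= in_itv /= => /andP[z0 zd].
have [Dz|Dz|Dz] := ltgtP 0 ((N%:R - 1) * delta + z).
- rewrite le_cost //; have [zy|zy] := leP z y.
    have h : alpha * z <= alpha * y by rewrite ler_pM2l.
    by apply: mulr_ge0; lra.
  have h : alpha * y <= alpha * z by rewrite ler_pM2l // ltW.
  by have h' := eq_p (lt_le_trans zy zd); apply: mulr_le0; lra.
- by move: Dz; rewrite ltNge addr_ge0.
(* D z = 0 forces N = 1 and z = 0, where the clearing price is +oo. *)
- have -> : z = 0 by move: Nm1_ge0; lra.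
  have D0 : ((N%:R - 1) * delta + 0) = 0 :> R by move: Nm1_ge0; lra.
  rewrite [leRHS]/operator_cost /clearing_price D0 inve0 subr0.
  by rewrite Bp !(gt0_muley, lte_fin) ?mulr_gt0 ?D_gt0 //= leey.
Qed.

(* KKT conditions with multiplier p of the balance constraint. *)
Definition competitive {R : realType} {N : nat} (delta alpha : R)
    (c : 'I_N -> R -> R) (a : ('I_N -> R) * R) (p : R) : Prop :=
  [/\ 0 < p /\ 0 < a.2,
      feasible delta a,
      forall n x, 0 <= x -> x <= delta ->
        p * (x - a.1 n) <= c n x - c n (a.1 n),
      alpha * ((N%:R - 1) * delta + a.2) <= N%:R * delta * p
    & a.2 < delta -> alpha * ((N%:R - 1) * delta + a.2) = N%:R * delta * p].

(** * Equilibria as KKT points *)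

Lemma payoffE {R : realType} (delta : R) (cn : R -> R) (bn p : R) : 0 < p ->
  payoff delta cn bn p = p * supply delta bn p - cn (supply delta bn p).
Proof.
by move=> p0; rewrite /payoff {2}/supply; field; rewrite gt_eqF.
Qed.

Lemma feasible_le {R : realType} {N : nat} {delta : R} {a : ('I_N -> R) * R} :
  feasible delta a -> a.2 <= delta /\ forall n, a.1 n <= delta.
Proof.
move=> [sum_a s0 y0]; split.
  have : 0 <= \sum_(n < N) a.1 n by exact: sumr_ge0.
  by lra.
move=> n; move: sum_a; rewrite (bigD1 n) //=.
have : 0 <= \sum_(i < N | i != n) a.1 i by exact: sumr_ge0.
by lra.
Qed.

Lemma sum_supply {R : realType} {N : nat} (delta p : R) (b : 'I_N -> R) :
  \sum_(n < N) supply delta (b n) p = N%:R * delta - (\sum_(n < N) b n) / p.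
Proof.
by rewrite sumrB sumr_const card_ord mulr_suml mulr_natl.
Qed.

(** For fixed p > 0, bids b >= 0 correspond bijectively to supplies s <= delta, and market clearing
    becomes the balance constraint. Negative supplies are never optimal: they cost nothing but earn
    p s < 0. *)
Lemma equilibriumP {R : realType} {N : nat} {delta alpha : R}
    {c : 'I_N -> R -> R} (b : 'I_N -> R) (y p : R) :
  (1 <= N)%N -> 0 < delta -> 0 < alpha -> (forall n, cost_function (c n)) ->
  price_taking_equilibrium delta alpha c b y p <->
  competitive delta alpha c (allocation delta b y p) p.
Proof.
move=> hN hdelta halpha hc.
have clear : 0 < y -> 0 < p -> p%:E = clearing_price delta b y <->
    \sum_(n < N) b n = p * ((N%:R - 1) * delta + y).
  move=> y0 p0; have D0 := denominator_gt0 hN hdelta y0.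
  rewrite /clearing_price inver gt_eqF // -EFinM; split=> [[->]|->].
    by rewrite divfK // gt_eqF.
  by rewrite mulfK // gt_eqF.
have feasE : 0 < p -> y + \sum_(n < N) supply delta (b n) p = delta <->
    \sum_(n < N) b n = p * ((N%:R - 1) * delta + y).
  move=> p0; rewrite sum_supply; split=> [h|->]; last by field; rewrite gt_eqF.
  have -> : \sum_(n < N) b n = (\sum_(n < N) b n) / p * p.
    by rewrite divfK // gt_eqF.
  by rewrite mulrC; congr (_ * _); lra.
split.
  move=> [[b0 [y0 p0]] opt /(clear y0 p0) Bp].
  move=> /(operator_argminP hN hdelta halpha y0 p0 Bp) [yd le_p eq_p].
  split=> //=.
  - split=> //=; [exact/feasE| |exact: ltW].
    move=> n; rewrite leNgt; apply/negP => sn.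
    (* The bid p delta supplies nothing and has payoff 0, which beats a negative supply. *)
    have s0 : supply delta (p * delta) p = 0.
      by rewrite /supply mulrAC divff ?gt_eqF // mul1r subrr.
    have [_ c0 _ _] := hc n; have := opt n (p * delta).
    rewrite !payoffE // s0 mulr0 !c0 ?(ltW sn) // !subr0 => H.
    have /H : 0 <= p * delta by rewrite mulr_ge0 // ltW.
    by apply/negP; rewrite -ltNge pmulr_rlt0.
  - move=> n x x0 xd; have := opt n (p * (delta - x)).
    have px : supply delta (p * (delta - x)) p = x.
      by rewrite /supply; field; rewrite gt_eqF.
    rewrite !payoffE // px => H.
    have /H : 0 <= p * (delta - x) by rewrite mulr_ge0 ?subr_ge0 // ltW.
    by lra.
move=> [/= [p0 y0] feas opt le_p eq_p].
have [yd sd] := feasible_le feas; have [/= sum_a s0 _] := feas.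
have Bp : \sum_(n < N) b n = p * ((N%:R - 1) * delta + y) by exact/feasE.
split=> //.
- split=> // n; have := sd n; rewrite /= /supply gerBl.
  by rewrite pmulr_lge0 // invr_gt0.
- move=> n bbar bbar0; rewrite !payoffE //.
  have xd : supply delta bbar p <= delta.
    by rewrite /supply gerBl divr_ge0 // ltW.
  have [x0|x0] := leP 0 (supply delta bbar p).
    by have := opt n _ x0 xd; lra.
  have [_ c0 _ _] := hc n; rewrite (c0 (supply delta bbar p)) ?(ltW x0) //.
  have := opt n 0 (lexx 0) (ltW hdelta); rewrite (c0 0) //.
  have : p * supply delta bbar p < 0 by rewrite pmulr_rlt0.
  by lra.
- exact/clear.
- by apply/(operator_argminP hN hdelta halpha y0 p0 Bp).
Qed.

(** * KKT conditions and optimality in the modified problem *)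

(** Adding the tenants' inequalities bounds the change of their costs below by p (y - y'). The
    quadratic term changes by at least q (y' - y), where [q] is its derivative at y, and (q - p)(y'
    - y) >= 0. *)
Lemma competitive_argmin {R : realType} {N : nat} {delta alpha : R}
    {c : 'I_N -> R -> R} {a : ('I_N -> R) * R} {p : R} :
  (1 <= N)%N -> 0 < delta -> 0 < alpha ->
  competitive delta alpha c a p ->
  is_argmin (feasible (N := N) delta) (modified_cost delta alpha c) a.
Proof.
move=> hN hdelta halpha [_ feas opt le_p eq_p]; split=> // a' feas'.
have [y'd s'd] := feasible_le feas'; have [sum_a' s'0 _] := feas'.
have [yd _] := feasible_le feas; have [sum_a _ _] := feas.
have N0 : 0 < N%:R :> R by rewrite ltr0n.
have costs : p * (a.2 - a'.2) <=
    \sum_(n < N) c n (a'.1 n) - \sum_(n < N) c n (a.1 n).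
  have -> : a.2 - a'.2 = \sum_(n < N) a'.1 n - \sum_(n < N) a.1 n by lra.
  by rewrite -!sumrB mulr_sumr ler_sum // => n _; exact: opt.
(* If a.2 = delta then p >= q, but also a'.2 <= a.2. *)
set q := alpha * ((N%:R - 1) * delta + a.2) / (N%:R * delta).
have marg : q * (a'.2 - a.2) >= p * (a'.2 - a.2).
  rewrite -subr_ge0 -mulrBl; have [yd'|yd'] := ltP a.2 delta.
    by rewrite /q (eq_p yd') mulrAC divff ?mulf_neq0 ?gt_eqF // mul1r subrr mul0r.
  by apply: mulr_le0; [rewrite subr_le0 ler_pdivrMr ?mulr_gt0 // [leRHS]mulrC|lra].
have quad : alpha / (2 * N%:R * delta) * (a'.2 + (N%:R - 1) * delta) ^+ 2 -
    alpha / (2 * N%:R * delta) * (a.2 + (N%:R - 1) * delta) ^+ 2 =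
    q * (a'.2 - a.2) + alpha / (2 * N%:R * delta) * (a'.2 - a.2) ^+ 2.
  by rewrite /q; field; rewrite !gt_eqF.
have : 0 <= alpha / (2 * N%:R * delta) * (a'.2 - a.2) ^+ 2.
  by rewrite mulr_ge0 ?sqr_ge0 // ltW // divr_gt0 // !mulr_gt0.
by rewrite /modified_cost; lra.
Qed.

Lemma modified_argmin_gt0 {R : realType} {N : nat} {delta alpha : R}
    {c : 'I_N -> R -> R} {a a0 : ('I_N -> R) * R} :
  (1 <= N)%N -> 0 < delta -> 0 < alpha ->
  is_argmin (feasible (N := N) delta) (social_cost alpha c) a0 -> 0 < a0.2 ->
  is_argmin (feasible (N := N) delta) (modified_cost delta alpha c) a ->
  0 < a.2.
Proof.
move=> hN hdelta halpha [feas0 opt0] y0 [feas opt].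
have N0 : 0 < N%:R :> R by rewrite ltr0n.
have [_ _ a20] := feas; rewrite lt_neqAle a20 andbT eq_sym; apply/eqP => a2.
have := opt0 _ feas; have := opt _ feas0.
have [y0d _] := feasible_le feas0.
rewrite /social_cost /modified_cost a2 mulr0 add0r.
(* Isolating alpha y* leaves a remainder with factor 2 delta - y*, positive since y* <= delta. *)
have -> : alpha / (2 * N%:R * delta) * (a0.2 + (N%:R - 1) * delta) ^+ 2 =
    alpha / (2 * N%:R * delta) * (0 + (N%:R - 1) * delta) ^+ 2 + alpha * a0.2
    - alpha / (2 * N%:R * delta) * (a0.2 * (2 * delta - a0.2)).
  by field; rewrite !gt_eqF.
have : 0 < alpha / (2 * N%:R * delta) * (a0.2 * (2 * delta - a0.2)).
  apply: mulr_gt0; first by rewrite divr_gt0 // !mulr_gt0.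
  by rewrite mulr_gt0 //; lra.
by lra.
Qed.

(** The price is the derivative of the quadratic term at [a.2], so the last two conditions hold with
    equality. For the tenants, move [a.1 n] a fraction t towards [x] and let generation compensate;
    convexity bounds the change of cost linearly in t. *)
Lemma argmin_competitive {R : realType} {N : nat} {delta alpha : R}
    {c : 'I_N -> R -> R} {a : ('I_N -> R) * R} :
  (1 <= N)%N -> 0 < delta -> 0 < alpha -> (forall n, cost_function (c n)) ->
  is_argmin (feasible (N := N) delta) (modified_cost delta alpha c) a ->
  0 < a.2 ->
  competitive delta alpha c a
    (alpha * ((N%:R - 1) * delta + a.2) / (N%:R * delta)).
Proof.
move=> hN hdelta halpha hc [feas opt] y0.
have N0 : 0 < N%:R :> R by rewrite ltr0n.
have D0 := denominator_gt0 hN hdelta y0.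
have pE : N%:R * delta * (alpha * ((N%:R - 1) * delta + a.2) / (N%:R * delta)) =
    alpha * ((N%:R - 1) * delta + a.2).
  by rewrite mulrC divfK // mulf_neq0 ?gt_eqF.
split; rewrite ?pE //; first by rewrite y0 divr_gt0 ?mulr_gt0.
move=> n x x0 xd; have [sum_a s0 _] := feas.
set h := x - a.1 n; set k := alpha / (2 * N%:R * delta).
rewrite -subr_ge0.
(* [k * h ^+ 2] is the second-order remainder of the quadratic term; the second bound on t keeps
   generation nonnegative. *)
apply: (@ge0_of_small_perturbation _ _ (k * h ^+ 2)
  (Num.min 1 (a.2 / (`|h| + 1)))).
  by rewrite lt_min ltr01 divr_gt0 // ltr_wpDl.
move=> t t0; rewrite le_min ler_pdivlMr ?ltr_wpDl // => /andP[t1 th].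
set v := t * x + (1 - t) * a.1 n.
have vE : v - a.1 n = t * h by rewrite /v /h; ring.
have v0 : 0 <= v by rewrite addr_ge0 // mulr_ge0 ?subr_ge0 // ltW.
have feas' : feasible delta
    ((fun i => if i == n then v else a.1 i), a.2 - t * h).
  split=> /=.
  - by rewrite (sum_update (F := fun=> id)) vE -[RHS]sum_a; ring.
  - by move=> i; case: ifP.
  - by rewrite subr_ge0 (le_trans _ th) // ler_pM2l //; have := ler_norm h; lra.
have := opt _ feas'; rewrite /modified_cost /= (sum_update (F := c)) -/k.
have := cost_convex (hc n) _ _ _ x0 (s0 n) (ltW t0) t1; rewrite -/v => cv.
have -> : k * (a.2 - t * h + (N%:R - 1) * delta) ^+ 2 =
    k * (a.2 + (N%:R - 1) * delta) ^+ 2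
    - t * (alpha * ((N%:R - 1) * delta + a.2) / (N%:R * delta) * h)
    + t * (t * (k * h ^+ 2)).
  by rewrite /k; field; rewrite !gt_eqF.
by move=> H; rewrite -(pmulr_rge0 _ t0); lra.
Qed.

(** * Uniqueness *)

Lemma competitive_unique {R : realType} {N : nat} {delta alpha : R}
    {c : 'I_N -> R -> R} {a a' : ('I_N -> R) * R} {p p' : R} :
  (1 <= N)%N -> 0 < delta -> 0 < alpha ->
  competitive delta alpha c a p -> competitive delta alpha c a' p' ->
  a'.2 = a.2 /\ (a.2 < delta -> p' = p).
Proof.
move=> hN hdelta halpha ca ca'.
have Nd0 : 0 < N%:R * delta by rewrite mulr_gt0 ?ltr0n.
have le_gen (a1 a2 : ('I_N -> R) * R) (p1 p2 : R) :
    competitive delta alpha c a1 p1 -> competitive delta alpha c a2 p2 ->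
    a2.2 <= a1.2.
  move=> [_ feas1 opt1 _ eq1] [_ feas2 opt2 le2 _].
  have [y1d s1d] := feasible_le feas1; have [y2d s2d] := feasible_le feas2.
  have [sum1 s1 _] := feas1; have [sum2 s2 _] := feas2.
  rewrite leNgt; apply/negP => y12.
  (* Here [a1.2 < delta], so [p1] is determined by its generation, while [p2] is at least the
     marginal cost at a larger one. *)
  have p12 : p1 < p2.
    rewrite -(ltr_pM2l Nd0) -(eq1 (lt_le_trans y12 y2d)).
    by apply: lt_le_trans le2; rewrite ltr_pM2l // ltrD2l.
  have h1 : p1 * (a1.2 - a2.2) <=
      \sum_(n < N) c n (a2.1 n) - \sum_(n < N) c n (a1.1 n).
    have -> : a1.2 - a2.2 = \sum_(n < N) a2.1 n - \sum_(n < N) a1.1 n by lra.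
    by rewrite -!sumrB mulr_sumr ler_sum // => n _; exact: opt1.
  have h2 : p2 * (a2.2 - a1.2) <=
      \sum_(n < N) c n (a1.1 n) - \sum_(n < N) c n (a2.1 n).
    have -> : a2.2 - a1.2 = \sum_(n < N) a1.1 n - \sum_(n < N) a2.1 n by lra.
    by rewrite -!sumrB mulr_sumr ler_sum // => n _; exact: opt2.
  by nra.
have yy : a'.2 = a.2.
  by apply/eqP; rewrite eq_le (le_gen _ _ _ _ ca ca') (le_gen _ _ _ _ ca' ca).
split=> // yd; have [_ _ _ _ /(_ yd) e] := ca; have [_ _ _ _] := ca'.
by rewrite yy e => /(_ yd); move/(mulfI (lt0r_neq0 Nd0)).
Qed.

(** Below delta the prices agree, and testing both optima at the midpoint of two distinct supplies
    contradicts strict convexity. At y = delta all supplies vanish. *)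
Lemma competitive_allocation_unique {R : realType} {N : nat} {delta alpha : R}
    {c : 'I_N -> R -> R} {a a' : ('I_N -> R) * R} {p p' : R} :
  (1 <= N)%N -> 0 < delta -> 0 < alpha ->
  (forall n, strictly_convex_nneg (c n)) ->
  competitive delta alpha c a p -> competitive delta alpha c a' p' -> a' = a.
Proof.
move=> hN hdelta halpha sc ca ca'.
have [yE pE] := competitive_unique hN hdelta halpha ca ca'.
have [_ feas opt _ _] := ca; have [_ feas' opt' _ _] := ca'.
have [yd sd] := feasible_le feas; have [_ sd'] := feasible_le feas'.
have [sum_a s0 _] := feas; have [sum_a' s0' _] := feas'.
rewrite (surjective_pairing a) (surjective_pairing a') yE; congr pair.
apply/funext => n; apply/eqP; apply: contraT => neq.
have [yd'|yd'] := ltP a.2 delta.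
  have half0 : 0 < 2^-1 :> R by rewrite invr_gt0.
  have half1 : 2^-1 < 1 :> R by lra.
  have := sc n _ _ _ (s0' n) (s0 n) neq half0 half1.
  set m := _ + _ * a.1 n => cm.
  have mE : m = (a'.1 n + a.1 n) / 2 by rewrite /m; field.
  have m0 : 0 <= m by rewrite mE; have := s0 n; have := s0' n; lra.
  have md : m <= delta by rewrite mE; have := sd n; have := sd' n; lra.
  have := opt n m m0 md; have := opt' n m m0 md.
  have -> : m - a.1 n = - (m - a'.1 n) by rewrite mE; field.
  by rewrite (pE yd'); lra.
have a0 (s : 'I_N -> R) : (forall i, 0 <= s i) ->
    \sum_(i < N) s i = 0 -> s n = 0.
  by move=> si /eqP; rewrite psumr_eq0 // => /allP/(_ n (mem_index_enum n))/eqP.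
by move: neq; rewrite (a0 a.1) ?(a0 a'.1) ?eqxx //; lra.
Qed.

(** * Existence of an optimum and conclusion *)

Lemma modified_argmin_exists {R : realType} {N : nat} {delta : R} (alpha : R)
    {c : 'I_N -> R -> R} : 0 < delta -> (forall n, continuous (c n)) ->
  exists a, is_argmin (feasible (N := N) delta) (modified_cost delta alpha c) a.
Proof.
move=> hdelta hc.
have sum_cont (F : 'I_N -> R -> R) : (forall i, continuous (F i)) ->
    continuous (fun v : 'rV[R]_N => \sum_(i < N) F i (v ord0 i)).
  move=> hF; apply: (continuous_big add_continuous) => i _ v.
  exact: (continuous_comp (@coord_continuous _ _ _ _ _ _) (hF i _)).
have hs : continuous (fun v : 'rV[R]_N => \sum_(i < N) v ord0 i).
  by apply: (sum_cont (fun=> id)) => i x; exact: cvg_id.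
(* Balance eliminates y; the supplies then range over a compact set of row vectors, where the
   extreme value theorem applies. *)
pose f (v : 'rV[R]_N) :=
  modified_cost delta alpha c (v ord0, delta - \sum_(i < N) v ord0 i).
pose K : set 'rV[R]_N := ([set v | forall i, `[0%R, delta]%classic (v ord0 i)]
  `&` [set v | (\sum_(i < N) v ord0 i <= delta)%R])%classic.
have K_compact : compact K.
  apply: compact_closedI.
    apply: (@rV_compact _ _ (fun=> `[0%R, delta]%classic)) => _.
    exact: segment_compact.
  apply: (@preimage_closed _ _ (fun v : 'rV[R]_N => \sum_(i < N) v ord0 i)
    [set x | (x <= delta)%R]%classic); last exact: closed_le.
  by move=> v _; exact: hs.
have K0 : (K !=set0)%classic.
  exists 0; split=> [i|] /=; rewrite ?mxE ?in_itv /= ?lexx ?ltW //.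
  by rewrite big1 ?ltW // => i _; rewrite mxE.
have f_cont : continuous f.
  have g_cont : continuous (fun x : R =>
      alpha / (2 * N%:R * delta) * (delta - x + (N%:R - 1) * delta) ^+ 2).
    have d_cont : continuous (fun x : R => delta - x + (N%:R - 1) * delta).
      move=> x; apply: cvgD; last exact: cvg_cst.
      by apply: cvgB; [exact: cvg_cst|exact: cvg_id].
    move=> x; apply: cvgM; first exact: cvg_cst.
    exact: (continuous_comp (d_cont x) (@exprn_continuous _ 2 _)).
  move=> v.
  exact: (cvgD (sum_cont c hc v) (continuous_comp (hs v) (g_cont _))).
have [v /set_mem[/= vI sumv] vmin] :=
  EVT_min_rV K0 K_compact (continuous_subspaceT f_cont).
exists (v ord0, delta - \sum_(i < N) v ord0 i); split.
  split=> /=; [by ring| |by rewrite subr_ge0].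
  by move=> n; have := vI n; rewrite in_itv /= => /andP[].
move=> a feas; have [yd sd] := feasible_le feas; have [sum_a s0 y0] := feas.
have sumE : \sum_(i < N) (\row_i a.1 i) ord0 i = \sum_(i < N) a.1 i.
  by apply: eq_bigr => i _; rewrite mxE.
have -> : a = ((\row_i a.1 i) ord0, delta - \sum_(i < N) (\row_i a.1 i) ord0 i).
  rewrite sumE [LHS]surjective_pairing; congr pair; last by lra.
  by apply/funext => i; rewrite mxE.
apply: vmin; apply/mem_set; split=> [i|] /=; last by rewrite sumE; lra.
by rewrite mxE in_itv /= s0 sd.
Qed.

(* Since the costs need not be strictly convex, the minimization problem may
   have several optimal solutions, and at y = delta the clearing price is only
   bounded below by alpha: for c_n(s) = 10 s on s >= 0 and alpha = 1, every
   p in [1, 10] with b_n = p * delta is an equilibrium.  Uniqueness is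
   therefore stated componentwise: the equilibrium allocations are exactly the
   optimal solutions, y is unique, p is unique when y < delta, the allocation
   is unique for strictly convex costs, and the whole triple (b, y, p) is
   unique when both conditions hold. *)
Theorem theorem3 (R : realType) (N : nat) (delta alpha : R)
    (c : 'I_N -> R -> R)
    (hN : (1 <= N)%N) (hdelta : 0 < delta) (halpha : 0 < alpha)
    (hc : forall n, cost_function (c n))
    (hopt : exists a : ('I_N -> R) * R,
        is_argmin (feasible (N := N) delta) (social_cost alpha c) a
        /\ 0 < a.2) :
  [/\ (exists (b : 'I_N -> R) (y p : R),
        price_taking_equilibrium delta alpha c b y p),
      (forall (b : 'I_N -> R) (y p : R),
        price_taking_equilibrium delta alpha c b y p ->
        is_argmin (feasible (N := N) delta) (modified_cost delta alpha c)
          (allocation delta b y p)),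
      (forall a : ('I_N -> R) * R,
        is_argmin (feasible (N := N) delta) (modified_cost delta alpha c) a ->
        exists (b : 'I_N -> R) (y p : R),
          price_taking_equilibrium delta alpha c b y p
          /\ allocation delta b y p = a)
    & (forall (b b' : 'I_N -> R) (y y' p p' : R),
        price_taking_equilibrium delta alpha c b y p ->
        price_taking_equilibrium delta alpha c b' y' p' ->
        [/\ y' = y,
            (y < delta -> p' = p),
            ((forall n, strictly_convex_nneg (c n)) ->
              allocation delta b' y' p' = allocation delta b y p)
          & ((forall n, strictly_convex_nneg (c n)) -> y < delta ->
              [/\ b' = b, y' = y & p' = p])])].
Proof.
have eqmP b y p := @equilibriumP _ _ _ _ c b y p hN hdelta halpha hc.
have [a0 [opt0 y00]] := hopt.
have onto (a : ('I_N -> R) * R) :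
    is_argmin (feasible (N := N) delta) (modified_cost delta alpha c) a ->
    exists (b : 'I_N -> R) (y p : R),
      price_taking_equilibrium delta alpha c b y p
      /\ allocation delta b y p = a.
  move=> opt; have y0 := modified_argmin_gt0 hN hdelta halpha opt0 y00 opt.
  have ca := argmin_competitive hN hdelta halpha hc opt y0.
  move: (X in competitive _ _ _ _ X) ca => p ca; have [[p0 _] _ _ _ _] := ca.
  (* The bids p (delta - s_n) invert the supply function at price p. *)
  have allocE : allocation delta (fun n => p * (delta - a.1 n)) a.2 p = a.
    rewrite [RHS]surjective_pairing /allocation; congr pair.
    by apply/funext => n; rewrite /supply; field; rewrite gt_eqF.
  exists (fun n => p * (delta - a.1 n)), a.2, p.
  by split=> //; apply/eqmP; rewrite allocE.
have alloc_unique (b b' : 'I_N -> R) (y y' p p' : R) :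
    price_taking_equilibrium delta alpha c b y p ->
    price_taking_equilibrium delta alpha c b' y' p' ->
    (forall n, strictly_convex_nneg (c n)) ->
    allocation delta b' y' p' = allocation delta b y p.
  move=> /eqmP ca /eqmP ca' sc.
  exact: (competitive_allocation_unique hN hdelta halpha sc ca ca').
split=> //.
- have hcont n : continuous (c n) by case: (hc n).
  have [a /onto[b [y [p [eqm _]]]]] := modified_argmin_exists alpha hdelta hcont.
  by exists b, y, p.
- by move=> b y p /eqmP; exact: competitive_argmin.
move=> b b' y y' p p' eqm eqm'.
have [/= yE pE] := competitive_unique hN hdelta halpha
  ((eqmP _ _ _).1 eqm) ((eqmP _ _ _).1 eqm').
split=> // [|sc yd]; first exact: alloc_unique.
have pp := pE yd; split=> //; apply/funext => n.
have [/(congr1 (fun s => s n))] := alloc_unique _ _ _ _ _ _ eqm eqm' sc.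
have [[_ [_ p0]] _ _ _] := eqm.
rewrite /supply pp => /addrI/oppr_inj + _.
by apply: mulIf; rewrite invr_eq0 gt_eqF.
Qed.
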